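(* For every integer $k\ge 3$ the generating function $F_{12\text{-}3\text{-}\cdots\text{-}k;r}(x)$, $0\le r\le k-2$, is a rational function given by $$F_{12\text{-}3\text{-}\cdots\text{-}k;r}(x)=\frac{x^{r-1}\,U_{k-2}^{\,r-1}\!\left(\frac1{2\sqrt x}\right)}{(1-x)^r\,U_k^{\,r+1}\!\left(\frac1{2\sqrt x}\right)}\qquad (1\le r\le k-2),$$ $$F_{12\text{-}3\text{-}\cdots\text{-}k;0}(x)=\frac{U_{k-1}\!\left(\frac1{2\sqrt x}\right)}{\sqrt x\,U_k\!\left(\frac1{2\sqrt x}\right)},$$ where $U_j$ is the $j$th Chebyshev polynomial of the second kind.
   Context: Generalized patterns: a generalized pattern is a permutation $\tau=\tau_1\cdots\tau_k$ of $\{1,\dots,k\}$ written with dashes between some of its adjacent letters. An occurrence of $\tau$ in $\pi=\pi_1\cdots\pi_n\in S_n$ is a choice of positions $i_1<\dots<i_k$ such that $(\pi_{i_1},\dots,\pi_{i_k})$ is order-isomorphic to $(\tau_1,\dots,\tau_k)$ and $i_{j+1}=i_j+1$ whenever there is no dash between $\tau_j$ and $\tau_{j+1}$. The pattern $12\text{-}3\text{-}\cdots\text{-}k$ requires only the first two letters to be adjacent in $\pi$. A permutation is $1\text{-}3\text{-}2$-avoiding if it has no occurrence of the classical (fully dashed) pattern $1\text{-}3\text{-}2$. $f_{\tau;r}(n)$ is the number of $1\text{-}3\text{-}2$-avoiding permutations in $S_n$ containing exactly $r$ occurrences of $\tau$ (with $S_0$ consisting of the empty permutation), and $F_{\tau;r}(x)=\sum_{n\ge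 0} f_{\tau;r}(n)x^n$. Chebyshev polynomials of the second kind: $U_j(\cos\theta)=\sin((j+1)\theta)/\sin\theta$. The exponents on $U$ denote powers. *)

(* Defs.v *)
From HB Require Import structures.
From mathcomp Require Import all_boot all_order all_algebra all_fingroup.
From mathcomp Require Import all_classical all_reals all_analysis.
From mathcomp Require Import ring.

Set Implicit Arguments.
Unset Strict Implicit.
Unset Printing Implicit Defensive.

Import Order.TTheory GRing.Theory Num.Theory.

Local Open Scope ring_scope.

(* Letters and positions are counted from 0.  [gp_dash a] tells whether there
   is a dash between the letters a and a+1; only a with a.+1 < gp_size matter. *)
Record gpattern := GPattern {
  gp_size : nat;
  gp_perm : 'S_gp_size;
  gp_dash : pred nat
}.

Definition is_occurrence (t : gpattern) (n : nat) (p : 'S_n)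
    (i : {ffun 'I_(gp_size t) -> 'I_n}) : bool :=
  [&& [forall a : 'I_(gp_size t), forall b : 'I_(gp_size t),
         (a < b)%N ==> (i a < i b)%N],
      [forall a : 'I_(gp_size t), forall b : 'I_(gp_size t),
         (p (i a) < p (i b))%N == (gp_perm t a < gp_perm t b)%N]
    & [forall a : 'I_(gp_size t), forall b : 'I_(gp_size t),
        (b == a.+1 :> nat) && ~~ gp_dash t a ==> (i b == (i a).+1 :> nat)]].

Definition occurrences (t : gpattern) (n : nat) (p : 'S_n) : nat :=
  #|[set i : {ffun 'I_(gp_size t) -> 'I_n} | is_occurrence p i]%SET|.

Definition pattern_1_3_2 : gpattern :=
  @GPattern 3 (tperm (inord 1) (inord 2)) xpredT.

Definition pattern_12_3_to (k : nat) : gpattern :=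
  @GPattern k 1%g (fun a => (a != 0)%N).

Definition avoids_132 (n : nat) (p : 'S_n) : bool :=
  (occurrences pattern_1_3_2 p == 0)%N.

Definition f132 (t : gpattern) (r n : nat) : nat :=
  #|[set p : 'S_n | avoids_132 p && (occurrences t p == r)]%SET|.

(* U_j, the polynomial singled out by U_j(cos th) = sin((j+1) th) / sin th;
   existence and uniqueness are chebyshevU_cos and chebyshevU_unique below. *)
Definition chebyshevU (R : realType) (j : nat) : {poly R} :=
  xget 0 [set p : {poly R} | forall th : R, sin th != 0 ->
            p.[cos th] = sin (j.+1%:R * th) / sin th]%classic.

Lemma chebyshevU_cos (R : realType) (j : nat) (th : R) : sin th != 0 ->
  (chebyshevU R j).[cos th] = sin (j.+1%:R * th) / sin th.
Proof.
pose P j (p : {poly R}) := forall th : R, sin th != 0 ->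
  p.[cos th] = sin (j.+1%:R * th) / sin th.
have [p [Pp _]] : exists p, P j p /\ exists q, P j.+1 q.
  elim: j => [|j [p [Pp [q Pq]]]].
    exists 1; split => [t t0|]; first by rewrite hornerC mul1r divff.
    exists (2%:R *: 'X) => t t0.
    rewrite hornerZ hornerX [2%:R * t]mulr_natl mulr2n sinD.
    by field.
  exists q; split=> //; exists (2%:R *: 'X * q - p) => t t0.
  rewrite hornerD hornerN hornerM hornerZ hornerX Pq// Pp// mulrA -mulrBl.
  have -> : j.+3%:R * t = j.+2%:R * t + t by rewrite -natr1 mulrDl mul1r.
  have -> : j.+1%:R * t = j.+2%:R * t - t.
    by rewrite -[j.+2%:R]natr1 mulrDl mul1r addrK.
  by rewrite sinB sinD; congr (_ / _); ring.
exact: (xgetPex 0 (ex_intro (P j) p Pp)).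
Qed.

Lemma chebyshevU_unique (R : realType) (j : nat) (p : {poly R}) :
  (forall th : R, sin th != 0 -> p.[cos th] = sin (j.+1%:R * th) / sin th) ->
  p = chebyshevU R j.
Proof.
move=> Pp; apply/eqP; rewrite -subr_eq0; apply/negPn/negP => d0.
pose s := [seq (n.+2%:R : R)^-1 | n <- iota 0 (size (p - chebyshevU R j))].
have := max_poly_roots d0 (rs := s).
rewrite size_map size_iota ltnn => H; suff: false by [].
apply: H; last first.
  rewrite map_inj_uniq ?iota_uniq// => m n /invr_inj/eqP.
  by rewrite eqr_nat => /eqP[].
apply/allP => _ /mapP[n _ ->]; set x := _^-1.
have x1 : -1 < x < 1.
  rewrite invf_lt1 ?ltr0n// ltr1n andbT (@lt_trans _ _ 0)// ?ltrN10//.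
  by rewrite invr_gt0 ltr0n.
have x1' : -1 <= x <= 1 by case/andP: x1 => /ltW-> /ltW->.
have s0 : sin (acos x) != 0.
  rewrite sin_acos// gt_eqF// sqrtr_gt0 subr_gt0.
  by rewrite -real_normK ?num_real// exprn_ilt1 ?normr_ge0// ltr_norml.
rewrite /root hornerD hornerN -[x]acosK ?in_itv//=.
by rewrite Pp// chebyshevU_cos// subrr.
Qed.

(* The field R(s), where the indeterminate s = sqrtx stands for the square
   root of x. *)
Section SqrtX.
Variable R : realType.

Definition sqrtx : {fraction {poly R}} := tofrac 'X.

Definition U_at (j : nat) : {fraction {poly R}} :=
  (map_poly (fun c : R => tofrac c%:P) (chebyshevU R j)).[1 / (2%:R * sqrtx)].

(* The formal power series sum_n a_n x^n is the rational function P(x) / Q(x),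
   i.e. it satisfies (sum_n a_n x^n) Q(x) = P(x) coefficientwise with Q
   invertible as a power series, and P(x) / Q(x) = phi in R(s), with x = s^2. *)
Definition gf_is_rational (a : nat -> nat) (phi : {fraction {poly R}}) : Prop :=
  exists P Q : {poly R},
    [/\ Q`_0 != 0,
        forall n : nat, \sum_(i < n.+1) (a i)%:R * Q`_(n - i) = P`_n
      & phi = tofrac (P \Po 'X^2) / tofrac (Q \Po 'X^2)].

End SqrtX.

(* Main.v *)
(* A nonempty 132-avoiding permutation is u n v with every letter of u above
   every letter of v.  Appending a maximum to u turns the occurrences of
   12-3-...-(j-1) in u into new ones of 12-3-...-j, so one has to follow the
   weights w_d = sum_i C(d,i) occ_{k-i} (the occurrences created after d larger
   letters were appended).  Their generating functions satisfy
     F_d = 1 / (1 - x (1 - q^c) - x q^c F_{d+1}),   c = C(d, k-2).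
   For d < k-2 the exponent c vanishes; for d = k-1 it is k-1, so modulo
   q^(k-1), which is all that r <= k-2 needs, F_{k-1} = 1/(1-x).  Unfolding,
     F_0 = (P - q P') / (Q - q Q')  mod q^(k-1)
   with P, P', Q, Q' given by the Chebyshev three-term recurrence; the
   coefficient of q^r (r >= 1) is Q'^(r-1) (P Q' - P' Q) / Q^(r+1), and the
   Casoratian P Q' - P' Q is the monomial (1-x) x^k. *)
Require Import Defs.
From mathcomp Require Import all_boot all_order all_algebra all_fingroup.
From mathcomp Require Import all_classical all_reals all_analysis.
From mathcomp Require Import zify ring.
Import Order.TTheory GRing.Theory Num.Theory.
Set Implicit Arguments.
Unset Strict Implicit.
Unset Printing Implicit Defensive.

(** * Pattern counts in words and their behaviour at the maximum *)

(** Counts the ways to extend an increasing chain ending in the value [v] by [j] entries of [s],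
    that is, to supply the trailing letters of a pattern. *)
Fixpoint increasing_above (s : seq nat) (j v : nat) : nat :=
  if j is j'.+1 then
    if s is y :: s' then
      (v < y) * increasing_above s' j' y + increasing_above s' j v
    else 0
  else 1.

(* The index is shifted: occ12 j counts the occurrences of 12-3-...-(j+2). *)
Fixpoint occ12 (j : nat) (s : seq nat) : nat :=
  if s is x :: s' then
    (if s' is y :: s'' then (x < y) * increasing_above s'' j y else 0)
    + occ12 j s'
  else 0.

(** Here [x] plays the letter 1, while [y], followed later by [z], play 3 and 2. *)
Fixpoint avoids (s : seq nat) : bool :=
  if s is x :: s' then
    pairwise (fun y z => ~~ ((x < z) && (z < y))) s' && avoids s'
  else true.

Lemma increasing_above0 s v : increasing_above s 0 v = 1.
Proof. by case: s. Qed.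

Lemma increasing_above_shift b s j v :
  increasing_above (map (addn b) s) j (b + v) = increasing_above s j v.
Proof.
by elim: s j v => [|y s IH] [|j] v //=; rewrite ltn_add2l !IH.
Qed.

Lemma occ12_shift b j s : occ12 j (map (addn b) s) = occ12 j s.
Proof.
elim: s => [|x [|y s] IH] //=.
by rewrite /= in IH; rewrite ltn_add2l increasing_above_shift IH.
Qed.

Lemma avoids_shift b s : avoids (map (addn b) s) = avoids s.
Proof.
elim: s => [|x s IH] //=; rewrite IH pairwise_map; congr (_ && _).
by apply: eq_pairwise => y z /=; rewrite !ltn_add2l.
Qed.

Lemma increasing_above_eq0 s j v :
  all (geq v) s -> increasing_above s j v = (j == 0).
Proof.
elim: s j => [|y s IH] [|j] //= /andP[vy vs].
by rewrite ltnNge vy (IH j.+1).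
Qed.

(** A chain above [x] never enters [v], whose entries are at most [x]. So [n] can only be its last
    entry, and the second term counts the chains ending there. *)
Lemma increasing_above_glue u n v j x :
  x < n -> all (gtn n) u -> all (gtn n) v -> all (geq x) v ->
  allrel geq u v ->
  increasing_above (u ++ n :: v) j x =
  increasing_above u j x + (if j is j'.+1 then increasing_above u j' x else 0).
Proof.
elim: u j x => [|y u IH] [|j] x //= xn un vn xv uv.
  rewrite xn mul1n (increasing_above_eq0 j.+1 xv) increasing_above_eq0.
    by case: j.
  by apply: sub_all vn => z; rewrite /= => /ltnW.
move: un uv => /andP[yn un]; rewrite allrel_consl => /andP[yv uv].
rewrite (IH j.+1)// IH//.
by case: j => [|j]; case: (x < y);
  rewrite ?increasing_above0 ?mul1n ?mul0n; lia.
Qed.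

Lemma occ12_cons_max j n v : all (gtn n) v -> occ12 j (n :: v) = occ12 j v.
Proof.
case: v => [|y v] //= /andP[yn _].
by rewrite ltnNge ltnW.
Qed.

Lemma occ12_cons2 j x y s :
  occ12 j (x :: y :: s) = (x < y) * increasing_above s j y + occ12 j (y :: s).
Proof. by []. Qed.

(** No occurrence runs from [u] or [n] into [v], and [n] can only play the last letter. A new
    occurrence is thus one of the next shorter pattern in [u] completed by [n]; for [j = 0] it is
    the ascent from the last letter of [u] to [n]. *)
Lemma occ12_glue u n v j : all (gtn n) u -> all (gtn n) v -> allrel geq u v ->
  occ12 j (u ++ n :: v) =
  occ12 j u + (if j is j'.+1 then occ12 j' u else nilp u == false)
  + occ12 j v.
Proof.
elim: u => [|x [|y u] IH].
- by move=> _ vn _; rewrite cat0s occ12_cons_max//; case: j.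
- rewrite allrel_consl => /andP[xn _] vn _.
  rewrite cat1s occ12_cons2 (occ12_cons_max _ vn) increasing_above_eq0.
    by rewrite [x < n]xn; case: (j) => [|i] /=; lia.
  by apply: sub_all vn => z; rewrite /= => /ltnW.
- rewrite [all _ _]/= !allrel_consl => /and3P[xn yn un] vn /and3P[xv yv uv].
  rewrite !cat_cons occ12_cons2 -cat_cons.
  rewrite IH ?allrel_consl/= ?yn ?un ?yv ?uv// increasing_above_glue//.
  by case: (j) => [|i]; case: (x < y);
    rewrite ?increasing_above0 ?mul1n ?mul0n /=; lia.
Qed.

(** With [n] as the 3, any letter of [u] smaller than a letter of [v] completes a 1-3-2. Once [u]
    dominates [v], no occurrence can meet both sides or use [n]. *)
Lemma avoids_glue u n v : all (gtn n) u -> all (gtn n) v ->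
  avoids (u ++ n :: v) = [&& allrel geq u v, avoids u & avoids v].
Proof.
move=> + vn; elim: u => [_|x u IH /= /andP[xn un]].
  rewrite /=; case: (avoids v); rewrite ?andbT ?andbF//.
  elim: v vn => //= y v IH /andP[yn vn]; rewrite (IH vn) andbT.
  apply/allP => z /(allP vn) /= zn; apply/negP; lia.
rewrite IH// allrel_consl pairwise_cat pairwise_cons allrel_consr.
have -> : all (fun z => ~~ ((x < z) && (z < n))) v = all (geq x) v.
  apply: eq_in_all => z /(allP vn) /= zn; lia.
case xv : (all (geq x) v) => /=; last by rewrite !andbF.
have -> : all (fun y => ~~ ((x < n) && (n < y))) u.
  by apply/allP => y /(allP un) /= yn; lia.
have -> : allrel (fun y z => ~~ ((x < z) && (z < y))) u v.
  by apply/allrelP => y z yu /(allP xv) /= zx; lia.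
have -> : pairwise (fun y z => ~~ ((x < z) && (z < y))) v.
  elim: v xv {vn IH} => //= y v IH /andP[yn vn]; rewrite (IH vn) andbT.
  by apply/allP => z /(allP vn) /= zn; lia.
by rewrite /= andbT andbCA -andbA.
Qed.

(** * Decomposition of avoiding words at their maximum *)

Definition avoiders n := [seq s <- permutations (iota 0 n) | avoids s].

Definition glue n (u v : seq nat) := map (addn (size v)) u ++ n :: v.

Lemma mem_avoiders n (s : seq nat) :
  (s \in avoiders n) = avoids s && perm_eq s (iota 0 n).
Proof. by rewrite mem_filter mem_permutations. Qed.

Lemma glue_avoiders n i (u v : seq nat) :
  i <= n -> u \in avoiders i -> v \in avoiders (n - i) ->
  glue n u v \in avoiders n.+1 /\ index n (glue n u v) = i.
Proof.
rewrite !mem_avoiders /glue => ni /andP[au pu] /andP[av pv].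
have su : size u = i by rewrite (perm_size pu) size_iota.
have sv : size v = n - i by rewrite (perm_size pv) size_iota.
have un : all (gtn n) (map (addn (size v)) u).
  rewrite all_map; apply/allP => x; rewrite (perm_mem pu) mem_iota /=; lia.
have vn : all (gtn n) v.
  by apply/allP => x; rewrite (perm_mem pv) mem_iota /=; lia.
split; last first.
  rewrite index_cat ifN ?size_map ?su /= ?eqxx ?addn0//.
  by apply/negP => /(allP un) /=; rewrite ltnn.
rewrite avoids_glue// avoids_shift au av !andbT; apply/andP; split.
  apply/allrelP => x z /mapP[y _ ->]; rewrite (perm_mem pv) mem_iota /=; lia.
have pu' : perm_eq [seq size v + x | x <- u] (iota (n - i) i).
  by rewrite -[X in iota X]addn0 iotaDl -sv perm_map.
rewrite -cat1s perm_catCA perm_sym -[n.+1]addn1 iotaD perm_catC perm_cons.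
rewrite -[X in iota 0 X](subnK ni) iotaD perm_sym perm_catC perm_cat//.
Qed.

(** Since [u] dominates [v] and shares no letter with it, counting forces [v] to use exactly the
    smallest [size v] letters; lowering [u] by [size v] then standardizes it. *)
Lemma split_avoiders n (s : seq nat) : s \in avoiders n.+1 ->
  exists2 i, i <= n & exists u v : seq nat,
   [/\ u \in avoiders i, v \in avoiders (n - i) & s = glue n u v].
Proof.
rewrite mem_avoiders => /andP[avs ps].
have us : uniq s by rewrite (perm_uniq ps) iota_uniq.
have ns : n \in s by rewrite (perm_mem ps) mem_iota /=; lia.
have [u [v es]] : exists u v : seq nat, s = u ++ n :: v.
  by case/splitPr: ns => u v; exists u, v.
rewrite {}es {ns} in avs ps us *.
have nuv x : x \in u ++ v -> x < n.
  have := perm_mem ps x; move: us.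
  rewrite mem_iota cat_uniq !mem_cat inE /= => /and4P[_ /norP[nu _] nv _].
  case: eqVneq => [->|xn]; first by rewrite (negPf nu) (negPf nv).
  rewrite /= => ->; lia.
have un : all (gtn n) u.
  by apply/allP => x xu; apply: nuv; rewrite mem_cat xu.
have vn : all (gtn n) v.
  by apply/allP => x xu; apply: nuv; rewrite mem_cat xu orbT.
move: avs; rewrite avoids_glue// => /and3P[/allrelP uv au av].
have suv : size u + size v = n.
  by have := perm_size ps; rewrite size_cat size_iota /=; lia.
have [uu nuvv /= /andP[nv uniqv]] :
    [/\ uniq u, ~~ has (mem u) v & uniq (n :: v)].
  by move: us; rewrite cat_uniq /= negb_or => /and4P[-> /andP[_ ->] -> ->].
have pv : perm_eq v (iota 0 (size v)).
  have sv : {subset v <= iota 0 (size v)}.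
    move=> z zv; rewrite mem_iota /= add0n.
    (* The letters of [u] lie strictly between [z] and [n]; counting them bounds [z]. *)
    have : size u <= size (iota z.+1 (n - z.+1)).
      apply: uniq_leq_size => // x xu; rewrite mem_iota.
      have := uv _ _ xu zv; have /= := allP un _ xu.
      case: (eqVneq x z) => [xz|/=]; last by lia.
      by move/hasPn: nuvv => /(_ z zv); rewrite /= -xz xu.
    by have /= := allP vn _ zv; rewrite size_iota; lia.
  apply: uniq_perm => //; first exact: iota_uniq.
  by case: (uniq_min_size uniqv sv) => //; rewrite size_iota.
have gu x : x \in u -> size v <= x.
  move=> xu; rewrite -(size_iota 0 x); apply: uniq_leq_size => // z zv.
  rewrite mem_iota /=; have := uv _ _ xu zv.
  case: (eqVneq x z) => [xz|/=]; last by lia.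
  by move/hasPn: nuvv => /(_ z zv); rewrite /= -xz xu.
have eu : map (addn (size v)) (map (subn^~ (size v)) u) = u.
  rewrite -map_comp -[RHS]map_id; apply/eq_in_map => x /gu /=; lia.
exists (size u); first lia.
exists (map (subn^~ (size v)) u), v; rewrite /glue eu; split=> //.
  rewrite mem_avoiders -(avoids_shift (size v)) eu au /=.
  apply: (perm_map_inj (@addnI (size v))); rewrite eu -iotaDl addn0.
  apply: uniq_perm => //; first exact: iota_uniq.
  case: (uniq_min_size (s2 := iota (size v) (size u)) uu) => //.
    by move=> x xu; rewrite mem_iota gu //=; have /= := allP un _ xu; lia.
  by rewrite size_iota.
by rewrite mem_avoiders av -suv addKn.
Qed.

(** Both lists are duplicate-free, so comparing members suffices. [glue] is injective here because
    [i] fixes the lengths of [u] and [v]. *)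
Lemma perm_avoiders_index n i : i <= n ->
  perm_eq [seq s <- avoiders n.+1 | index n s == i]
          [seq glue n u v | u <- avoiders i, v <- avoiders (n - i)].
Proof.
move=> ni; apply: uniq_perm.
- by rewrite !filter_uniq// permutations_uniq.
- apply: allpairs_uniq; rewrite ?filter_uniq ?permutations_uniq//.
  move=> [u v] [u' v'] /allpairsP[[a b] /= [ai bi [-> ->]]].
  move=> /allpairsP[[c d] /= [ci di [-> ->]]].
  have sz j w : w \in avoiders j -> size w = j.
    by rewrite mem_avoiders => /andP[_ /perm_size ->]; rewrite size_iota.
  rewrite /glue (sz _ _ bi) (sz _ _ di) => /eqP.
  rewrite eqseq_cat ?size_map ?(sz _ _ ai) ?(sz _ _ ci)//.
  move=> /andP[/eqP/inj_map-> //]; last exact: addnI.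
  by rewrite eqseq_cons => /andP[_ /eqP ->].
- move=> s; rewrite mem_filter; apply/andP/allpairsP.
    move=> [/eqP idx /split_avoiders [j jn [u [v [uj vj es]]]]].
    have [_] := glue_avoiders jn uj vj; rewrite -es idx => eij.
    by exists (u, v); rewrite eij.
  move=> [[u v] /= [ui vi ->]].
  by have [-> ->] := glue_avoiders ni ui vi.
Qed.

(** Sorting by the position of the maximum gives the Catalan recursion for an arbitrary statistic
    [F]. *)
Lemma big_avoidersS (M : nmodType) n (F : seq nat -> M) :
  (\sum_(s <- avoiders n.+1) F s =
  \sum_(i < n.+1) \sum_(u <- avoiders i) \sum_(v <- avoiders (n - i))
    F (glue n u v))%R.
Proof.
transitivity (\sum_(i < n.+1) \sum_(s <- avoiders n.+1 | index n s == i) F s)%R.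
  rewrite (exchange_big_dep xpredT)//= big_seq [RHS]big_seq.
  apply: eq_bigr => s sn.
  have lt : index n s < n.+1.
    have [i ni [u [v [ui vi es]]]] := split_avoiders sn.
    by have [_] := glue_avoiders ni ui vi; rewrite es => ->.
  by rewrite (big_pred1 (Ordinal lt))// => i; rewrite -val_eqE /= eq_sym.
apply: eq_bigr => i _; rewrite -big_filter.
have ni : i <= n by rewrite -ltnS.
by rewrite (perm_big _ (perm_avoiders_index ni)) big_allpairs_dep.
Qed.

(** * Weights that anticipate larger letters *)

(* weight d m = sum_i 'C(d, i) * occ12 (m - i), over i <= m. *)
Fixpoint weight (d m : nat) (s : seq nat) : nat :=
  if d is d'.+1 then
    weight d' m s + (if m is m'.+1 then weight d' m' s else 0)
  else occ12 m s.

Lemma weight_nil d m : weight d m [::] = 0.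
Proof. by elim: d m => //= d IH [|m]; rewrite !IH. Qed.

(** For [u], the letter [n] is one more larger letter, hence [d.+1]. The ascent into [n], present
    when [u] is nonempty, is completed by choosing [m] of the [d] later letters, hence the binomial.
    The induction on [d] is Pascal's rule. *)
Lemma weight_glue d m n i (u v : seq nat) : i <= n ->
  u \in avoiders i -> v \in avoiders (n - i) ->
  weight d m (glue n u v)
    = weight d.+1 m u + weight d m v + (i != 0) * 'C(d, m).
Proof.
rewrite !mem_avoiders => ni /andP[au pu] /andP[av pv].
have su : size u = i by rewrite (perm_size pu) size_iota.
have sv : size v = n - i by rewrite (perm_size pv) size_iota.
elim: d m => [|d IH] m; last first.
  by case: m => [|m]; rewrite ![weight _.+1 _ _]/= !IH ?bin0 ?binS /=; lia.
rewrite /= occ12_glue.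
- rewrite occ12_shift bin0n; case: m => [|m];
    last by rewrite occ12_shift muln0; lia.
  have -> : (nilp (map (addn (size v)) u) == false) = (i != 0).
    by rewrite /nilp size_map su; case: (i == 0).
  by rewrite muln1; lia.
- rewrite all_map; apply/allP => x; rewrite (perm_mem pu) mem_iota /=; lia.
- by apply/allP => x; rewrite (perm_mem pv) mem_iota /=; lia.
- by apply/allrelP => x z /mapP[y _ ->]; rewrite (perm_mem pv) mem_iota /=; lia.
Qed.

(** * From permutations and position functions to words *)

Section Word.
Variables (n : nat) (p : 'S_n).

Definition word : seq nat := [seq val (p i) | i <- enum 'I_n].

Let size_word : size word = n.
Proof. by rewrite size_map size_enum_ord. Qed.

Lemma nth_word (i : 'I_n) : nth 0 word i = p i.
Proof. by rewrite (nth_map i) ?size_enum_ord// nth_ord_enum. Qed.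

Let drop_word (h : 'I_n) : drop h word = val (p h) :: drop h.+1 word.
Proof. by rewrite (drop_nth 0) ?size_word// nth_word. Qed.

Let big_leq (h : 'I_n) (P : pred 'I_n) (F : 'I_n -> nat) :
  \sum_(y : 'I_n | (h <= y) && P y) F y =
  (if P h then F h else 0) + \sum_(y : 'I_n | (h.+1 <= y) && P y) F y.
Proof.
rewrite (bigID (pred1 h)) /=; congr (_ + _).
  case: ifP => Ph; last first.
    by rewrite big1// => y /andP[/andP[_ Py] /eqP yh]; rewrite yh Ph in Py.
  rewrite (big_pred1 h)// => y /=.
  by case: eqVneq => [->|]; rewrite ?leqnn ?Ph// andbF.
apply: eq_bigl => y; rewrite -val_eqE /= ltn_neqAle eq_sym.
by rewrite -andbA [P y && _]andbC andbA [(h <= y) && _]andbC.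
Qed.

(** Turns the list recursion into a sum over the position of the next letter, the form in which
    occurrences are enumerated. *)
Lemma increasing_above_word h j v :
  increasing_above (drop h word) j.+1 v =
  \sum_(y : 'I_n | (h <= y) && (v < p y))
     increasing_above (drop y.+1 word) j (p y).
Proof.
(* Induction on the length of the remaining suffix. *)
move: {2}(n - h) (erefl (n - h)) => d; elim: d h => [|d IH] h dE.
  rewrite drop_oversize ?size_word -?subn_eq0 ?dE//= big1// => y /andP[hy _].
  by have := ltn_ord y; lia.
have hn : h < n by lia.
have -> : h = Ordinal hn by [].
rewrite drop_word big_leq /= IH; last lia.
by case: ifP; rewrite ?mul1n.
Qed.

Lemma occ12_word h j :
  occ12 j (drop h word) =
  \sum_(x : 'I_n | h <= x) \sum_(y : 'I_n | (y == x.+1 :> nat) && (p x < p y))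
     increasing_above (drop y.+1 word) j (p y).
Proof.
move: {2}(n - h) (erefl (n - h)) => d; elim: d h => [|d IH] h dE.
  rewrite drop_oversize ?size_word -?subn_eq0 ?dE//= big1// => y hy.
  by have := ltn_ord y; lia.
have hn : h < n by lia.
have -> : h = Ordinal hn by [].
under eq_bigl do rewrite -[_ <= _]andbT.
rewrite (big_leq _ xpredT) drop_word [LHS]/= IH; last by rewrite /=; lia.
congr (_ + _); last by apply: eq_bigl => y; rewrite andbT.
have [hn'|hn'] := ltnP h.+1 n; last first.
  rewrite drop_oversize ?size_word// big1// => y /andP[/eqP yh _].
  by have := ltn_ord y; rewrite /= in yh; lia.
rewrite (drop_word (Ordinal hn')) /=.
case hp: (p _ < p (Ordinal hn')); rewrite ?mul1n ?mul0n.
  rewrite (big_pred1 (Ordinal hn'))// => y; rewrite /= -(val_eqE y) /=.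
  case: eqVneq => //= yh; have -> : y = Ordinal hn' by apply: val_inj.
  by rewrite hp.
rewrite big1// => y /andP[/eqP yh].
have -> : y = Ordinal hn' by apply: val_inj.
by rewrite hp.
Qed.

Definition above : rel 'I_n := [rel x y : 'I_n | (x < y) && (p x < p y)].

Lemma above_trans : transitive above.
Proof.
move=> y x z /= /andP[xy pxy] /andP[yz pyz].
by apply/andP; split; [exact: ltn_trans xy yz|exact: ltn_trans pxy pyz].
Qed.

End Word.

(** Lets a sum over occurrences be unfolded one position at a time. *)
Definition ffun_cons (T : Type) k (x : T) (f : {ffun 'I_k -> T}) :
  {ffun 'I_k.+1 -> T} := [ffun i => oapp f x (unlift ord0 i)].

Lemma codom_ffun_cons (T : Type) k (x : T) (f : {ffun 'I_k -> T}) :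
  codom (ffun_cons x f) = x :: codom f.
Proof.
rewrite /codom /image_mem !enumT -!enumT enum_ordSl /= ffunE unlift_none /=.
congr (_ :: _); rewrite -map_comp; apply: eq_map => i /=.
by rewrite ffunE liftK.
Qed.

Lemma big_ffun_cons (T : finType) k (F : {ffun 'I_k.+1 -> T} -> nat) :
  \sum_f F f = \sum_x \sum_(f : {ffun 'I_k -> T}) F (ffun_cons x f).
Proof.
rewrite pair_big /= (reindex (fun u => ffun_cons u.1 u.2))//.
exists (fun f : {ffun 'I_k.+1 -> T} =>
          (f ord0, [ffun i : 'I_k => f (lift ord0 i)])) => [[x f] _|f _] /=.
  rewrite ffunE unlift_none /=; congr (_, _); apply/ffunP => i.
  by rewrite !ffunE liftK.
apply/ffunP => i; rewrite ffunE; case: unliftP => [j|] -> //=.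
by rewrite ffunE.
Qed.

Lemma sum_path_word n (p : 'S_n) j x :
  \sum_(f : {ffun 'I_j -> 'I_n}) path (above p) x (codom f) =
  increasing_above (drop x.+1 (word p)) j (p x).
Proof.
elim: j x => [|j IH] x.
  rewrite increasing_above0.
  under eq_bigr => f _.
    have -> : codom f = [::] by apply: size0nil; rewrite size_codom card_ord.
    over.
  by rewrite sum1_card card_ffun !card_ord.
rewrite big_ffun_cons increasing_above_word [RHS]big_mkcond.
apply: eq_bigr => y _; under eq_bigr do rewrite codom_ffun_cons /=.
case xy : (above p x y); rewrite [X in if X then _ else _]xy;
  last by rewrite big1.
by rewrite -IH.
Qed.

(** By transitivity of [above], comparing consecutive positions is enough; trichotomy then upgrades
    the implication on values to an equivalence. *)
Lemma increasing_codom n (p : 'S_n) k (f : {ffun 'I_k -> 'I_n}) :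
  [forall a : 'I_k, forall b : 'I_k, (a < b) ==> (f a < f b)] &&
  [forall a : 'I_k, forall b : 'I_k, (p (f a) < p (f b)) == (a < b)]
  = sorted (above p) (codom f).
Proof.
rewrite sorted_pairwise; last exact: above_trans.
rewrite /codom /image_mem pairwise_map.
have so : pairwise (fun a b : 'I_k => a < b) (enum 'I_k).
  have : pairwise ltn (map val (enum 'I_k)).
    by rewrite val_enum_ord -(sorted_pairwise ltn_trans) iota_ltn_sorted.
  by rewrite pairwise_map.
apply/andP/idP => [[/forallP fI /forallP pI]|fI].
  apply: sub_pairwise so => a b /= ab.
  apply/andP; split; first by have /forallP/(_ b)/implyP/(_ ab) := fI a.
  by have /forallP/(_ b)/eqP -> := pI a.
have H (a b : 'I_k) : a < b -> (f a < f b) && (p (f a) < p (f b)).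
  have /pairwiseP := fI => /(_ a a b); rewrite !inE size_enum_ord !nth_ord_enum.
  by apply.
split; apply/forallP => a; apply/forallP => b.
  by apply/implyP => /H/andP[].
case: (ltngtP a b) => [/H/andP[_ ->]//|/H/andP[_ ba]|/val_inj->].
  by rewrite ltnNge ltnW.
by rewrite ltnn.
Qed.

(** The first two positions are split off because they alone are subject to adjacency; the remaining
    ones form a path for [above]. *)
Lemma occurrences_12_3_to n (p : 'S_n) j :
  occurrences (pattern_12_3_to j.+2) p = occ12 j (word p).
Proof.
rewrite /occurrences -sum1dep_card big_mkcond /=.
rewrite (big_ffun_cons (k := j.+1)) -[word p]drop0 occ12_word /=.
apply: eq_bigr => x _; rewrite (big_ffun_cons (k := j)) [RHS]big_mkcond.
apply: eq_bigr => y _.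
have occE (f : {ffun 'I_j -> 'I_n}) :
  @is_occurrence (pattern_12_3_to j.+2) n p (ffun_cons x (ffun_cons y f))
  = [&& y == x.+1 :> nat, p x < p y & path (above p) y (codom f)].
  set g := ffun_cons x _; rewrite /is_occurrence /=.
  have -> : [forall a : 'I_j.+2, forall b : 'I_j.+2,
      (p (g a) < p (g b)) == ((1%g : 'S_j.+2) a < (1%g : 'S_j.+2) b)] =
    [forall a : 'I_j.+2, forall b : 'I_j.+2, (p (g a) < p (g b)) == (a < b)].
    by apply: eq_forallb => a; apply: eq_forallb => b; rewrite !perm1.
  rewrite andbA increasing_codom !codom_ffun_cons [sorted _ _]/= andbC.
  (* The only gap without a dash follows letter 0, so adjacency reduces to one equation. *)
  have -> : [forall a : 'I_j.+2, forall b : 'I_j.+2,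
      (b == a.+1 :> nat) && ~~ (a != 0 :> nat) ==> (g b == (g a).+1 :> nat)]
    = (y == x.+1 :> nat).
    have g0 : g ord0 = x by rewrite ffunE unlift_none.
    have g1 : g (lift ord0 ord0) = y
      by rewrite ffunE liftK /= ffunE unlift_none.
    apply/idP/idP => [/forallP/(_ ord0)/forallP/(_ (lift ord0 ord0))|xy].
      by rewrite g0 g1.
    apply/forallP => a; apply/forallP => b; apply/implyP => /andP[ab].
    rewrite negbK => /eqP a0; have -> : a = ord0 by apply: val_inj.
    have -> : b = lift ord0 ord0
      by apply: val_inj; move: ab; rewrite a0 => /eqP.
    by rewrite g0 g1.
  case: (y == x.+1 :> nat) / eqP => //= yx.
  by rewrite /above /= [in x < y]yx ltnSn.
under eq_bigr do rewrite occE.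
rewrite -sum_path_word; case: ifP => yx.
  by apply: eq_bigr => f _; rewrite andbA yx; case: (path _ _ _).
by rewrite big1// => f _; rewrite andbA yx.
Qed.

Lemma avoidsP s : reflect
  (forall i j l, i < j -> j < l -> l < size s ->
     ~~ ((nth 0 s i < nth 0 s l) && (nth 0 s l < nth 0 s j)))
  (avoids s).
Proof.
elim: s => [|x s IH] /=; first by left => i j l.
apply: (iffP andP) => [[/(pairwiseP 0) xs /IH IHs] [|i] [|j] [|l]//=|H].
- by move=> _ jl ls; apply: xs; rewrite ?inE//; lia.
- by move=> ij jl ls; apply: IHs.
split.
  apply/(pairwiseP 0) => j l; rewrite !inE => js ls jl.
  exact: (H 0 j.+1 l.+1).
by apply/IH => i j l ij jl ls; apply: (H i.+1 j.+1 l.+1).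
Qed.

Lemma pattern_1_3_2E (a : 'I_3) :
  gp_perm pattern_1_3_2 a = nth 0 [:: 0; 2; 1] a :> nat.
Proof.
by case: a => [[|[|[|//]]] i3] /=; rewrite permE /= -!val_eqE /= !inordK.
Qed.

Lemma avoids_132E n (p : 'S_n) : avoids_132 p = avoids (word p).
Proof.
apply/idP/avoidsP => [|av].
  rewrite /avoids_132 /occurrences cards_eq0 => /eqP occ0 i j l ij jl.
  rewrite size_map size_enum_ord => ln.
  have jn := ltn_trans jl ln; have ni := ltn_trans ij jn.
  rewrite !(nth_word p (Ordinal ni), nth_word p (Ordinal jn),
            nth_word p (Ordinal ln)).
  set x := Ordinal ni; set y := Ordinal jn; set z := Ordinal ln.
  apply/negP => /andP[xz zy]; have xy := ltn_trans xz zy.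
  pose f : {ffun 'I_3 -> 'I_n} := [ffun a : 'I_3 => nth x [:: x; y; z] a].
  suff : f \in (finset.set0 : {set {ffun 'I_3 -> 'I_n}}) by rewrite inE.
  rewrite -[finset.set0]occ0 inE; apply/and3P; split;
    apply/forallP => a; apply/forallP => b.
  - rewrite !ffunE; case: a b => [[|[|[|//]]] a3] [[|[|[|//]]] b3] //=; lia.
  - rewrite !pattern_1_3_2E !ffunE.
    case: a b => [[|[|[|//]]] a3] [[|[|[|//]]] b3] //=; lia.
  (* Every gap of 1-3-2 is dashed, so the adjacency clause is vacuous. *)
  - by rewrite /= andbF.
rewrite /avoids_132 /occurrences cards_eq0; apply/eqP/setP => f; rewrite !inE.
apply/negP => /and3P[/forallP fI /forallP fp _].
pose o0 := ord0 : 'I_3; pose o1 := lift o0 ord0 : 'I_3.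
pose o2 := ord_max : 'I_3.
have i01 : f o0 < f o1 by have /forallP/(_ o1) := fI o0.
have i12 : f o1 < f o2 by have /forallP/(_ o2) := fI o1.
have := av _ _ _ i01 i12; rewrite !nth_word size_map size_enum_ord ltn_ord.
have /forallP/(_ o2) := fp o0; rewrite !pattern_1_3_2E /= => /eqP ->.
have /forallP/(_ o1) := fp o2; rewrite !pattern_1_3_2E /= => /eqP ->.
by move=> /(_ isT).
Qed.

(** [word] is injective with values among the permutations of [iota 0 n], and both sides have n!
    elements. *)
Lemma perm_words n :
  perm_eq [seq word p | p <- enum [set: 'S_n]%SET] (permutations (iota 0 n)).
Proof.
have wI : injective (@word n).
  by move=> p q pq; apply/permP => i; apply/val_inj;
    rewrite /= -(nth_word p) pq nth_word.
have uw : uniq [seq word p | p <- enum [set: 'S_n]%SET].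
  by rewrite map_inj_uniq ?enum_uniq.
apply: uniq_perm => //; first exact: permutations_uniq.
case: (uniq_min_size uw (s2 := permutations (iota 0 n))) => //.
  move=> _ /mapP[p _ ->]; rewrite mem_permutations.
  rewrite -val_enum_ord /word (map_comp val p) perm_map//.
  apply: uniq_perm; [|exact: enum_uniq|].
    by rewrite (map_inj_uniq (@perm_inj _ p)) enum_uniq.
  move=> i; rewrite mem_enum; apply/mapP; exists (p^-1%g i).
    by rewrite mem_enum.
  by rewrite permKV.
rewrite size_permutations ?iota_uniq// size_iota size_map -cardE cardsT.
by rewrite card_Sn.
Qed.

Lemma f132_12_3_to j r n :
  f132 (pattern_12_3_to j.+2) r n = \sum_(s <- avoiders n) (occ12 j s == r).
Proof.
rewrite /f132 -sum1dep_card /avoiders big_filter -(perm_big _ (perm_words n)).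
rewrite big_map big_enum_cond big_mkcond [RHS]big_mkcond /=.
apply: eq_bigr => p _.
rewrite inE avoids_132E occurrences_12_3_to; by case: (avoids _).
Qed.

(** * The Chebyshev recurrence over a ring *)

Local Open Scope ring_scope.

(* Up to a power of sqrt x, [useq x j.+1] is U_j(1/(2 sqrt x)). *)
Fixpoint useq (A : pzRingType) (x : A) (j : nat) : A :=
  if j is j'.+1 then
    if j' is j''.+1 then useq x j' - x * useq x j'' else 1
  else 0.

Lemma useqSS (A : pzRingType) (x : A) j :
  useq x j.+2 = useq x j.+1 - x * useq x j.
Proof. by []. Qed.

Lemma rmorph_useq (A B : pzRingType) (f : {rmorphism A -> B}) (x : A) j :
  f (useq x j) = useq (f x) j.
Proof.
elim/ltn_ind: j => [[|[|j]]] IH; first exact: rmorph0.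
  exact: rmorph1.
by rewrite !useqSS rmorphB rmorphM !IH.
Qed.

(** Gives the constant terms, hence the invertibility of the denominators as power series. *)
Lemma useq0S (A : pzRingType) j : useq (0 : A) j.+1 = 1.
Proof. by elim: j => // j IH; rewrite useqSS mul0r subr0. Qed.

(** The recurrence multiplies this determinant by [x] at each step, starting from 1. *)
Lemma useq_casoratian (A : comPzRingType) (x : A) j :
  useq x j.+2 * useq x j.+1 - useq x j * useq x j.+3 = x ^+ j.
Proof.
elim: j => [|j IH]; first by rewrite /= expr0; ring.
by rewrite exprS -IH !useqSS; ring.
Qed.

(** * Truncated congruence of bivariate series *)

Section Congruence.
Variables (A : comNzRingType) (K N : nat).
Implicit Types u v w : {poly {poly A}}.

(* In [{poly {poly A}}] the outer variable is x and the inner one is q; this is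
   congruence modulo the ideal (q^K, x^N). *)
Definition trunc_eq u v :=
  forall n r, (n < N)%N -> (r < K)%N -> u`_n`_r = v`_n`_r.

Lemma trunc_eq_trans v u w : trunc_eq u v -> trunc_eq v w -> trunc_eq u w.
Proof. by move=> uv vw n r nN rK; rewrite uv// vw. Qed.

Lemma trunc_eqB u u' v v' : trunc_eq u u' -> trunc_eq v v' ->
  trunc_eq (u - v) (u' - v').
Proof. by move=> uu vv n r nN rK; rewrite !coefB uu// vv. Qed.

Lemma trunc_eqM w u v : trunc_eq u v -> trunc_eq (w * u) (w * v).
Proof.
move=> uv n r nN rK; rewrite !coefM !coef_sum; apply: eq_bigr => i _.
rewrite !coefM; apply: eq_bigr => j _; rewrite uv//.
  by rewrite (leq_ltn_trans _ nN)// leq_subr.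
by rewrite (leq_ltn_trans _ rK)// leq_subr.
Qed.

Lemma trunc_eq_mulqK u : trunc_eq (u * ('X^K)%:P) 0.
Proof. by move=> n r nN rK; rewrite coefMC coefMXn rK !coef0. Qed.

(** Substitutes F' = P / Q into F = 1 / (1 - x (1 - e) - x e F') without dividing: the two relations
    are multiplied by [Q] and by [x * e * F]. *)
Lemma trunc_eq_step (x e F F' P Q : {poly {poly A}}) :
  trunc_eq (F * (1 - x * (1 - e) - x * e * F')) 1 ->
  trunc_eq (F' * Q) P ->
  trunc_eq (F * (Q - x * (1 - e) * Q - x * e * P)) Q.
Proof.
move=> /(trunc_eqM Q); rewrite mulr1 => FF' /(trunc_eqM (x * e * F)) F'Q.
apply: trunc_eq_trans FF' => n r nN rK.
have -> : F * (Q - x * (1 - e) * Q - x * e * P) =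
  F * (Q - x * (1 - e) * Q) - x * e * F * P by ring.
have -> : Q * (F * (1 - x * (1 - e) - x * e * F')) =
  F * (Q - x * (1 - e) * Q) - x * e * F * (F' * Q) by ring.
by rewrite !coefB F'Q.
Qed.

End Congruence.

(** * Generating functions of the weights as a finite continued fraction *)

Section GeneratingFunction.
Variables (A : comNzRingType) (m : nat).

Definition weight_poly d n : {poly A} :=
  \sum_(s <- avoiders n) 'X^(weight d m s).

Lemma weight_poly0 d : weight_poly d 0 = 1.
Proof.
rewrite /weight_poly; have -> : avoiders 0 = [:: [::]] by [].
by rewrite big_seq1 weight_nil expr0.
Qed.

Lemma weight_polyS d n : weight_poly d n.+1 =
  \sum_(i < n.+1) 'X^((i != 0 :> nat) * 'C(d, m)) * weight_poly d.+1 i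
                  * weight_poly d (n - i).
Proof.
rewrite /weight_poly big_avoidersS; apply: eq_bigr => i _.
rewrite -mulrA big_distrl big_distrr /=; apply: eq_big_seq => u ui.
rewrite big_distrr big_distrr /=; apply: eq_big_seq => v vi.
have ni : (i <= n)%N by rewrite -ltnS.
by rewrite (weight_glue d m ni ui vi) !exprD mulrC mulrA.
Qed.

Variable N : nat.

(** A polynomial stands in for the power series; the cutoff is invisible modulo x^N. *)
Definition weight_gf d : {poly {poly A}} := \poly_(n < N) weight_poly d n.

Lemma weight_gf_rec K d : let e := ('X^('C(d, m)))%:P in
  trunc_eq K N
    (weight_gf d * (1 - 'X * (1 - e) - 'X * e * weight_gf d.+1)) 1.
Proof.
move=> e n r nN rK; congr (nth 0 (polyseq _) r).
have -> : weight_gf d * (1 - 'X * (1 - e) - 'X * e * weight_gf d.+1) =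
  weight_gf d - weight_gf d * (1 - e) * 'X
  - weight_gf d.+1 * weight_gf d * e * 'X by ring.
rewrite !coefB !coefMX coef1 /weight_gf !coef_poly.
case: n nN => [|n] nN; first by rewrite /= nN weight_poly0 !subr0.
rewrite nN /= weight_polyS.
have -> : 1 - e = (1 - 'X^('C(d, m)))%:P by rewrite polyCB polyC1.
rewrite !coefMC coef_poly (ltnW nN) coefM.
under [X in _ - X * _]eq_bigr => i _.
  rewrite !coef_poly (leq_ltn_trans (leq_ord i) (ltnW nN)).
  rewrite (leq_ltn_trans (leq_subr i n) (ltnW nN)).
  over.
(* The term with empty [u] creates no ascent and so lacks the factor [e]; isolating it produces the
   correction 1 - e. *)
rewrite !big_ord_recl !weight_poly0 /= expr0 !mul1r subn0.
under eq_bigr do rewrite mul1n -mulrA.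
by rewrite -big_distrr /=; ring.
Qed.

(** Since C(m+1, m) = m+1, here [e] vanishes modulo q^(m+1), which cuts the continued fraction
    off. *)
Lemma weight_gf_last : trunc_eq m.+1 N (weight_gf m.+1 * (1 - 'X)) 1.
Proof.
have := @weight_gf_rec m.+1 m.+1; rewrite binSn /=.
set e := _%:P; apply: trunc_eq_trans => n r nN rK.
have -> : weight_gf m.+1 * (1 - 'X) =
 (weight_gf m.+1 * (1 - 'X * (1 - e) - 'X * e * weight_gf m.+2)) -
 'X * weight_gf m.+1 * (1 - weight_gf m.+2) * e by ring.
by rewrite coefB [LHS]coefB (trunc_eq_mulqK _ nN rK) !coef0 subr0.
Qed.

(** Climbs back from [d = m] to smaller [d]. The factor q enters once, at [d = m]; each later level
    is F = 1 / (1 - x F'), which advances numerator and denominator by the recurrence of [useq]. *)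
Lemma weight_gf_frac j : (j <= m)%N ->
  let q : {poly {poly A}} := 'X%:P in
  trunc_eq m.+1 N
    (weight_gf (m - j) *
      ((1 - 'X) * useq 'X j.+3 - q * 'X^2 * useq 'X j.+1))
    ((1 - 'X) * useq 'X j.+2 - q * 'X^2 * useq 'X j).
Proof.
move=> + q; elim: j => [_|j IH jm].
  have := @weight_gf_rec m.+1 m; rewrite subn0 binn expr1 /= => rec.
  have := trunc_eq_step rec weight_gf_last.
  rewrite !mulr0 !subr0 !mulr1 -/q.
  by set u := (X in _ * X); set v := (X in _ -> trunc_eq _ _ (_ * X) _);
    have -> : u = v by rewrite /u /v; ring.
have := @weight_gf_rec m.+1 (m - j.+1).
(* Below level [m] the binomial is 0, so [e = 1]. *)
rewrite bin_small ?expr0; last by rewrite ltn_subLR; lia.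
rewrite -subSn// subSS => rec.
have := trunc_eq_step rec (IH (ltnW jm)).
set u := (X in _ * X); set v := (X in _ -> trunc_eq _ _ (_ * X) _).
have -> // : u = v.
by rewrite /u /v !useqSS polyC1; ring.
Qed.

End GeneratingFunction.

(** * Extraction of the coefficient of q^r *)

Section Coefficients.
Variables (A : comNzRingType).
Local Notation lift := (map_poly (@polyC A)).

Lemma coef_weight_gf m N n r : (n < N)%N ->
  (weight_gf A m N 0)`_n`_r = (f132 (pattern_12_3_to m.+2) r n)%:R.
Proof.
move=> nN; rewrite coef_poly nN coef_sum f132_12_3_to natr_sum.
by apply: eq_bigr => s _; rewrite coefXn eq_sym.
Qed.

Lemma coef_lift_mulqn (Z : {poly A}) i n r :
  (lift Z * ('X^i)%:P)`_n`_r = Z`_n * (r == i)%:R.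
Proof. by rewrite coefMC coef_map coefCM coefXn. Qed.

Lemma coef_mul_lift (F : {poly {poly A}}) (Z : {poly A}) n r :
  (F * lift Z)`_n`_r = \sum_(i < n.+1) F`_i`_r * Z`_(n - i).
Proof.
by rewrite coefM coef_sum; apply: eq_bigr => i _; rewrite coef_map coefMC.
Qed.

(** The coefficient of q^r in (P - q P') / (Q - q Q'), cleared of its denominator Q^(r+1). The bound
    on [r] keeps it within the precision q^(m+1). *)
Lemma f132_convolution m r n : (r <= m)%N ->
  let P : {poly A} := (1 - 'X) * useq 'X m.+2 in
  let P' : {poly A} := 'X^2 * useq 'X m in
  let Q : {poly A} := (1 - 'X) * useq 'X m.+3 in
  let Q' : {poly A} := 'X^2 * useq 'X m.+1 in
  \sum_(i < n.+1) (f132 (pattern_12_3_to m.+2) r i)%:R * (Q ^+ r.+1)`_(n - i) =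
  (if r is r'.+1 then Q' ^+ r' * (P * Q' - P' * Q) else P)`_n.
Proof.
move=> rm P P' Q Q'; pose q : {poly {poly A}} := 'X%:P.
have liftE Z j : lift (Z * useq 'X j) = lift Z * useq 'X j.
  by rewrite rmorphM /= (rmorph_useq lift) /= map_polyX.
have lift1X : lift (1 - 'X) = 1 - 'X by rewrite rmorphB rmorph1 /= map_polyX.
have liftX2 : lift 'X^2 = 'X^2 by rewrite rmorphXn /= map_polyX.
have := @weight_gf_frac A m n.+1 m (leqnn m); lazy zeta; rewrite subnn -/q.
have -> : (1 - 'X) * useq 'X m.+3 - q * 'X^2 * useq 'X m.+1
    = lift Q - q * lift Q'.
  by rewrite /P /P' /Q /Q' !liftE lift1X liftX2 -mulrA.
have -> : (1 - 'X) * useq 'X m.+2 - q * 'X^2 * useq 'X m = lift P - q * lift P'.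
  by rewrite /P /P' /Q /Q' !liftE lift1X liftX2 -mulrA.
clearbody P P' Q Q' => {liftE lift1X liftX2}.
(* The cofactor of Q - q Q' in Q^(r+1) - (q Q')^(r+1); the second power is a multiple of q^(r+1) and
   does not reach q^r. *)
pose S := \sum_(i < r.+1) lift Q ^+ (r - i) * (q * lift Q') ^+ i.
move=> /(trunc_eqM S)/(_ n r (ltnSn n)).
rewrite ltnS => /(_ rm).
have -> : S * (weight_gf A m n.+1 0 * (lift Q - q * lift Q')) =
  weight_gf A m n.+1 0 * lift (Q ^+ r.+1) -
  weight_gf A m n.+1 0 * lift (Q' ^+ r.+1) * ('X^(r.+1))%:P.
  rewrite mulrCA [S * _]mulrC -subrXX exprMn mulrBr -!rmorphXn /=.
  by rewrite [X in _ - _ * X]mulrC [in LHS]mulrA.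
rewrite coefB [LHS]coefB coef_mul_lift.
rewrite [(_ * ('X^_)%:P)`_n]coefMC coefMXn ltnSn subr0.
have -> : S * (lift P - q * lift P') =
  \sum_(i < r.+1) (lift (P * (Q ^+ (r - i) * Q' ^+ i)) * ('X^i)%:P
                - lift (P' * (Q ^+ (r - i) * Q' ^+ i)) * ('X^(i.+1))%:P).
  rewrite big_distrl /=; apply: eq_bigr => i _.
  rewrite !rmorphM /= !rmorphXn /= exprS -/q exprMn.
  by ring.
rewrite !coef_sum.
under [in RHS]eq_bigr do rewrite !coefB !coef_lift_mulqn.
move=> E.
transitivity
  (\sum_(i < n.+1) (weight_gf A m n.+1 0)`_i`_r * (Q ^+ r.+1)`_(n - i)).
  by apply: eq_bigr => i _; rewrite coef_weight_gf.
(* In the sum with [P] only [i = r] contributes to q^r. *)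
rewrite {}E sumrB big_ord_recr /= big1 ?add0r; last first.
  by move=> i _; rewrite gtn_eqF ?mulr0.
rewrite eqxx mulr1 subnn expr0 mul1r.
case: r {rm S} => [|r].
  by rewrite big_ord1 /= mulr0 subr0 expr0 mulr1.
(* In the sum with [P'] the extra factor q shifts the contributing index to [r - 1], in the original
   numbering of [r]. *)
rewrite big_ord_recr /= big_ord_recr /= big1 ?add0r; last first.
  by move=> i _; rewrite gtn_eqF ?mulr0 ?oppr0// !ltnS.
rewrite eqxx ltn_eqF// mulr0 addr0 mulr1 subSnn expr1 -coefB.
by congr (nth 0 (polyseq _) n); rewrite exprS; ring.
Qed.

End Coefficients.

(** * Chebyshev polynomials at 1/(2 sqrt x) *)

Lemma horner_useq (A : comNzRingType) (c : A) j : (useq 'X j).[c] = useq c j.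
Proof.
rewrite -[LHS]/(horner_eval c _) (rmorph_useq (horner_eval c)) /=.
by rewrite horner_evalE hornerX.
Qed.

(** Multiplying [U j] by [s ^+ j] clears the division by [s] and turns the recurrence into that of
    [useq] at s^2. *)
Lemma three_term_useq (F : fieldType) (s : F) (U : nat -> F) :
  s != 0 -> U 0 = 1 -> U 1 = s^-1 -> (forall j, U j.+2 = U j.+1 / s - U j) ->
  forall j, U j = useq (s ^+ 2) j.+1 / s ^+ j.
Proof.
move=> s0 U0 U1 USS; elim/ltn_ind => [[|[|j]]] IH.
- by rewrite U0 expr0 divr1.
- by rewrite U1 /= mulr0 subr0 expr1 mul1r.
- rewrite USS !IH// [useq _ j.+3]useqSS !exprS.
  have := expf_neq0 j s0; move: (s ^+ j) => t t0.
  by field; rewrite s0 t0.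
Qed.

Section Chebyshev.
Variable R : realType.

Lemma chebyshevU0 : chebyshevU R 0 = 1.
Proof.
by apply/esym/chebyshevU_unique => t t0; rewrite hornerC mul1r divff.
Qed.

Lemma chebyshevU1 : chebyshevU R 1 = 2%:R *: 'X.
Proof.
apply/esym/chebyshevU_unique => t t0.
rewrite hornerZ hornerX [2%:R * t]mulr_natl mulr2n sinD.
by field.
Qed.

(** The addition formula sin((j+3)t) + sin((j+1)t) = 2 cos t sin((j+2)t), lifted to polynomials by
    uniqueness. *)
Lemma chebyshevUSS j :
  chebyshevU R j.+2 = 2%:R *: 'X * chebyshevU R j.+1 - chebyshevU R j.
Proof.
apply/esym/chebyshevU_unique => t t0.
rewrite hornerD hornerN hornerM hornerZ hornerX !chebyshevU_cos//.
have -> : j.+3%:R * t = j.+2%:R * t + t by rewrite -natr1 mulrDl mul1r.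
have -> : j.+1%:R * t = j.+2%:R * t - t.
  by rewrite -[j.+2%:R]natr1 mulrDl mul1r addrK.
by rewrite sinB sinD; field.
Qed.

Let s : {fraction {poly R}} := sqrtx R.
Let cst : {rmorphism R -> {fraction {poly R}}} := @tofrac {poly R} \o polyC.

Lemma sqrtx_neq0 : sqrtx R != 0.
Proof. by rewrite tofrac_eq0 polyX_eq0. Qed.

Lemma U_atE j : U_at R j = useq (sqrtx R ^+ 2) j.+1 / sqrtx R ^+ j.
Proof.
(* Presents the coefficient embedding as a ring morphism, so that it passes through the
   recurrence. *)
have UE i : U_at R i = (map_poly cst (chebyshevU R i)).[1 / (2%:R * s)] by [].
have two0 : 2%:R != 0 :> {fraction {poly R}}.
  rewrite -(rmorph_nat (@tofrac {poly R})) tofrac_eq0 -polyC_natr polyC_eq0.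
  by rewrite pnatr_eq0.
have cst2 : cst 2%:R * (1 / (2%:R * s)) = s^-1.
  by rewrite rmorph_nat div1r invfM mulVKf.
apply: three_term_useq => [||| i]; rewrite ?UE.
- exact: sqrtx_neq0.
- by rewrite chebyshevU0 rmorph1 hornerC.
- by rewrite chebyshevU1 map_polyZ map_polyX hornerZ hornerX.
- rewrite chebyshevUSS rmorphB rmorphM /= map_polyZ map_polyX hornerD hornerN.
  by rewrite hornerM hornerZ hornerX cst2 mulrC.
Qed.

Lemma tofrac_useq_comp j :
  tofrac (useq ('X : {poly R}) j \Po 'X^2) = useq (sqrtx R ^+ 2) j.
Proof.
rewrite (rmorph_useq (comp_poly 'X^2)) /= comp_polyX.
by rewrite (rmorph_useq (@tofrac {poly R})) /= rmorphXn.
Qed.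

End Chebyshev.

(** * Matching the fractions and conclusion *)

Lemma gf_fraction0 (F : fieldType) (s y a b : F) m :
  s != 0 -> y != 0 ->
  a / s ^+ m.+1 / (s * (b / s ^+ m.+2)) = (y * a) / (y * b).
Proof.
(* As the inverse of 0 is 0, both sides vanish when [b = 0]. *)
move=> s0 y0; have [->|b0] := eqVneq b 0.
  by rewrite !(mul0r, mulr0, invr0).
rewrite [s ^+ m.+2]exprS; have := expf_neq0 m.+1 s0; move: (s ^+ m.+1) => t t0.
by field; rewrite s0 t0 b0 y0.
Qed.

(** With [m = k - 2], [a / s ^+ m] stands for U_(k-2) and [b / s ^+ m.+2] for U_k; the right side is
    Q'^r times the Casoratian, over Q^(r+2). The powers of [s] balance. *)
Lemma gf_fraction (F : fieldType) (s a b : F) m r :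
  let x := s ^+ 2 in s != 0 -> 1 - x != 0 ->
  x ^+ r * (a / s ^+ m) ^+ r
    / ((1 - x) ^+ r.+1 * (b / s ^+ m.+2) ^+ r.+2)
  = (x ^+ 2 * a) ^+ r * ((1 - x) * x ^+ 2 * x ^+ m) / ((1 - x) * b) ^+ r.+2.
Proof.
move=> x s0 x1; have [->|b0] := eqVneq b 0.
  by rewrite !(mul0r, mulr0, expr0n, invr0).
rewrite [s ^+ m.+2]exprS [s ^+ m.+1]exprS [x ^+ m]exprAC.
have := expf_neq0 m s0; move: (s ^+ m) => t t0.
rewrite /x !expr2 !(expr_div_n, exprMn) ![_ ^+ r.+2]exprS ![_ ^+ r.+1]exprS.
have := expf_neq0 r s0; have := expf_neq0 r t0; have := expf_neq0 r b0.
have := expf_neq0 r x1; rewrite /x expr2 in x1 *.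
move: (s ^+ r) (t ^+ r) (b ^+ r) (a ^+ r) ((1 - s * s) ^+ r) => sr tr br ar xr.
by move=> xr0 br0 tr0 sr0; field; rewrite s0 t0 b0 x1 xr0 br0 tr0 sr0.
Qed.

Theorem theorem2p8 (R : realType) (k : nat) (hk : (3 <= k)%N) :
  let x : {fraction {poly R}} := sqrtx R ^+ 2 in
  (forall r : nat, (1 <= r <= k - 2)%N ->
     gf_is_rational (f132 (pattern_12_3_to k) r)
       (x ^+ (r - 1) * U_at R (k - 2) ^+ (r - 1)
        / ((1 - x) ^+ r * U_at R k ^+ (r + 1))))
  /\ gf_is_rational (f132 (pattern_12_3_to k) 0)
       (U_at R (k - 1) / (sqrtx R * U_at R k)).
Proof.
move=> x; case: k hk => [|[|m]]// _; rewrite !subSS subn0.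
pose P : {poly R} := (1 - 'X) * useq 'X m.+2.
pose P' : {poly R} := 'X^2 * useq 'X m.
pose Q : {poly R} := (1 - 'X) * useq 'X m.+3.
pose Q' : {poly R} := 'X^2 * useq 'X m.+1.
have Q0 : Q`_0 != 0.
  rewrite -horner_coef0 hornerM hornerD hornerN hornerC hornerX subr0 mul1r.
  by rewrite horner_useq useq0S oner_neq0.
have Qr0 r : (Q ^+ r)`_0 != 0.
  by rewrite -horner_coef0 horner_exp expf_neq0// horner_coef0.
have s0 : sqrtx R != 0 := sqrtx_neq0 R.
(* The substitution x = s^2 as a single ring morphism. *)
pose subst : {rmorphism {poly R} -> {fraction {poly R}}} :=
  @tofrac {poly R} \o comp_poly 'X^2.
have substX : subst 'X = x by rewrite /= comp_polyX rmorphXn.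
have substu j : subst (useq 'X j) = useq x j by exact: tofrac_useq_comp.
have subst1X : subst (1 - 'X) = 1 - x by rewrite rmorphB rmorph1 substX.
have x1 : 1 - x != 0.
  (* The polynomial 1 - s^2 takes the value 1 at 0. *)
  rewrite -subst1X tofrac_eq0; apply/eqP => /(congr1 (horner_eval 0)).
  rewrite !horner_evalE horner_comp hornerXn expr0n hornerD hornerN hornerC.
  by rewrite hornerX horner0 subr0 => /eqP; rewrite oner_eq0.
split=> [[//|r] /andP[_ rm]|].
  exists (Q' ^+ r * (P * Q' - P' * Q)), (Q ^+ r.+2); split=> [||].
  - exact: Qr0.
  - by move=> n; exact: (@f132_convolution R m r.+1 n rm).
  - rewrite -[RHS]/(subst _ / subst _).
    (* Pulling out the factors 1 - x and x^2 leaves the Casoratian of [useq]. *)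
    have -> : P * Q' - P' * Q = (1 - 'X) * 'X^2 * 'X^m.
      by rewrite -(useq_casoratian 'X m) /P /P' /Q /Q'; ring.
    rewrite !U_atE subSS subn0 addn1 (gf_fraction _ _ _ _ s0 x1).
    rewrite [subst (_ ^+ _ * _)]rmorphM rmorphXn [subst Q']rmorphM.
    rewrite [subst ((1 - 'X) * _ * _)]rmorphM [subst ((1 - 'X) * _)]rmorphM.
    rewrite [subst (Q ^+ _)]rmorphXn [subst Q]rmorphM.
    by rewrite !(rmorphXn subst) substX subst1X !substu.
exists P, Q; split=> [||].
- exact: Q0.
- by move=> n; exact: (@f132_convolution R m 0 n isT).
- rewrite -[RHS]/(subst _ / subst _) /P /Q [subst (_ * useq _ m.+2)]rmorphM.
  rewrite [subst (_ * useq _ m.+3)]rmorphM subst1X !substu !U_atE subn0.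
  (* [P] and [Q] share the factor 1 - x, which cancels. *)
  by rewrite (gf_fraction0 _ _ _ s0 x1).
Qed.
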